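(* Let $G_0 \subset (0,1/2)$ be an open set that is bounded away from $0$ and consists of a finite number of intervals, and let $G_1$ be the interior of the complement $(0,1/2)\setminus G_0$. Then there exists a (discrete-time, real-valued) stationary random process $(X_k)_k$ such that for all $\gamma \in G_0\cup G_1$ and all $c\in(0,\infty)$, \[ \lim_{n\to\infty} \frac{1}{n^{2\gamma}} \ln \mathbb{P}\left( \frac{X_1+\dots+X_n}{\sqrt n} > c\, n^{\gamma} \right) = \begin{cases} -\frac12 c^2 & \text{if } \gamma\in G_1,\\ 0 & \text{if } \gamma\in G_0. \end{cases} \]
   Context: A discrete-time stationary random process $(X_k)_k$ (indexed by $k\in\mathbb{Z}$) is a family of real random variables on some probability space such that for every $n$ the joint distribution of $X_m,\dots,X_{m+n}$ does not depend on $m$. The $X_k$ need not be independent. *)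

(* Defs.v *)
From HB Require Import structures.
From mathcomp Require Import all_boot all_order all_algebra.
From mathcomp Require Import all_classical all_reals all_analysis.

Set Implicit Arguments.
Unset Strict Implicit.
Unset Printing Implicit Defensive.

Import Order.TTheory GRing.Theory Num.Theory.
Import numFieldNormedType.Exports.

Local Open Scope classical_set_scope.
Local Open Scope ring_scope.

(* The list may be empty and the intervals may overlap or touch. *)
Definition finite_union_of_intervals (R : realType) (A : set R) : Prop :=
  exists s : seq (interval R), A = \big[setU/set0]_(I <- s) [set` I].

Definition bounded_away_from0 (R : realType) (A : set R) : Prop :=
  exists2 e : R, 0 < e & forall x, A x -> e <= `|x|.

Section stationary.
Context (d : measure_display) (T : measurableType d) (R : realType).
Variable P : probability T R.

(* (X_m, ..., X_(m+n)); tuples carry the product sigma-algebra *)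
Definition window (X : int -> {RV P >-> R}) (m : int) (n : nat) (w : T)
    : n.+1.-tuple R :=
  [tuple X (m + (i : nat)%:Z) w | i < n.+1].

(* The laws are compared on measurable sets only, since [pushforward] is a
   function on all sets. *)
Definition stationary (X : int -> {RV P >-> R}) : Prop :=
  forall (n : nat) (m m' : int) (A : set (n.+1.-tuple R)),
    measurable A ->
    pushforward P (window X m n) A =
    pushforward P (window X m' n) A.

End stationary.

(* Main.v *)
(* The process is a mixture of randomly phased periodic signals.  For each half
   period N and each peak m <= N take the triangle wave h on Z/2N rising from 0
   to m with slope m/N, and let X_k be the increment of h at (uniform phase) + k.
   Sums over n consecutive times are at most m * min(n, N) / N, and reach m when
   n = N for one phase in 2N.  The pair (N, m) is drawn with probability
   exp(- cost N m) up to factors polynomial in N, where cost N m = m^2 / 2N unless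
   m = N^(1/2 + g) with g in G0, in which case it is m^2 / (2N (1 + ln N)).
   Lower bounds come from N = n and the first integer m above c n^(1/2 + gamma).
   For the upper bound with gamma in G1, a signal whose n-sums exceed
   c n^(1/2 + gamma) satisfies m^2 / N >= c^2 n^(2 gamma) max(n / N, N / n), so the
   discount 1 + ln N can only matter when n and N agree up to a logarithmic
   factor; then m > c n^(1/2 + gamma) forces g, which stays at distance at least
   delta from gamma, to exceed gamma + delta, and the cost is larger by a power
   of N. *)

Require Import Defs.
From HB Require Import structures.
From mathcomp Require Import all_boot all_order all_algebra.
From mathcomp Require Import all_classical all_reals all_analysis.
From mathcomp Require Import ring lra zify.

Import Order.TTheory GRing.Theory Num.Theory.
Import numFieldNormedType.Exports.

Local Open Scope classical_set_scope.
Local Open Scope ring_scope.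

(** * Triangle waves on a cycle and their increments *)

Section walk.
Variable R : realType.

(* [n] is the half period minus 1, so that the phases form the ring ['I_n.*2.+2]. *)
Definition tent n (i : 'I_n.*2.+2) : nat := minn i (n.*2.+2 - i).

Definition walk n (m : nat) (i : 'I_n.*2.+2) : R := m%:R / n.+1%:R * (tent n i)%:R.

Lemma tent_le n (i : 'I_n.*2.+2) : (tent n i <= n.+1)%N.
Proof. rewrite /tent; have := ltn_ord i; lia. Qed.

Lemma tent_step n (i : 'I_n.*2.+2) : (tent n (i + 1)%R <= (tent n i).+1)%N.
Proof.
rewrite /tent /= (@modn_small 1) //.
have := ltn_ord i.
rewrite leq_eqVlt => /orP[/eqP iE|i_lt].
  by rewrite addn1 iE modnn min0n.
by rewrite modn_small addn1 //; lia.
Qed.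

Lemma walk_ge0 n m i : 0 <= walk n m i.
Proof. by rewrite /walk mulr_ge0// divr_ge0. Qed.

Lemma walk_le n m i : walk n m i <= m%:R.
Proof.
rewrite /walk mulrAC ler_pdivrMr ?ltr0n// ler_wpM2l// ler_nat.
exact: tent_le.
Qed.

Lemma walk_step n m (i : 'I_n.*2.+2) :
  walk n m (i + 1) - walk n m i <= m%:R / n.+1%:R.
Proof.
rewrite /walk -mulrBr ler_piMr ?divr_ge0// lerBlDl natr1 ler_nat.
exact: tent_step.
Qed.

Lemma walk0 n m : walk n m 0 = 0.
Proof. by rewrite /walk /tent min0n mulr0. Qed.

Lemma walk_peak n m : walk n m n.+1%:R = m%:R.
Proof.
have Nlt : (n.+1 < n.*2.+2)%N by lia.
have -> : n.+1%:R = Ordinal Nlt :> 'I_n.*2.+2.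
  by apply: val_inj; rewrite Zp_nat /= modn_small.
rewrite /walk /tent /= (_ : minn _ _ = n.+1); first by rewrite divfK ?pnatr_eq0.
by lia.
Qed.

(** The sample space is [nat] with every set measurable, so measurability comes for free; a sample
    encodes layer, peak and phase. *)
Definition code (n m j : nat) : nat := pickle (n, m, j).

(** Mass will sit only on codes of triples with [j] below the period; the default triple and the
    reduction by [inZp] make the function total. *)
Definition wave (k : int) (w : nat) : R :=
  let: (n, m, j) := odflt (0, 0, 0)%N (unpickle w) in
  walk n m (inZp j + (k + 1)%:~R) - walk n m (inZp j + k%:~R).

Lemma waveE k n m (j : 'I_n.*2.+2) : wave k (code n m j) =
  walk n m (j + (k + 1)%:~R) - walk n m (j + k%:~R).
Proof. by rewrite /wave /code pickleK /= valZpK. Qed.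

(** Advancing time by [d] amounts to rotating the phase by [d]; stationarity rests on this. *)
Lemma wave_shift k d n m (j : 'I_n.*2.+2) :
  wave (k + d) (code n m j) =
  wave k (code n m (j + d%:~R)%R).
Proof.
rewrite !waveE [k + d]addrC -addrA !intrD.
by rewrite !addrA.
Qed.

Lemma sum_wave p n m (j : 'I_n.*2.+2) :
  \sum_(1 <= k < p.+1) wave k%:Z (code n m j) =
  walk n m (j + p.+1%:R) - walk n m (j + 1).
Proof.
have := @telescope_sumr R 1 p.+1 (fun k => walk n m (j + k%:R)) isT.
move=> <-; apply: eq_bigr => k _.
by rewrite waveE -PoszD addn1.
Qed.

Lemma sum_wave_le_peak p n m (j : 'I_n.*2.+2) :
  \sum_(1 <= k < p.+1) wave k%:Z (code n m j) <= m%:R.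
Proof.
by rewrite sum_wave lerBlDr (le_trans (walk_le _ _ _))// lerDl walk_ge0.
Qed.

Lemma sum_wave_le_slope p n m (j : 'I_n.*2.+2) :
  \sum_(1 <= k < p.+1) wave k%:Z (code n m j) <=
  p%:R * (m%:R / n.+1%:R).
Proof.
apply: (@le_trans _ _ (\sum_(1 <= k < p.+1) (m%:R / n.+1%:R : R))).
  apply: ler_sum => k _; rewrite waveE intrD addrA.
  exact: walk_step.
by rewrite sumr_const_nat subn1 /= -[leLHS]mulr_natl.
Qed.

(** Sums start at time 1, so phase -1 makes the first increment leave from height 0; [n.+1]
    increments then climb exactly to the peak. *)
Lemma sum_wave_peak n m :
  \sum_(1 <= k < n.+2) wave k%:Z (code n m (- 1 : 'I_n.*2.+2)%R) =
  m%:R.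
Proof. by rewrite sum_wave addNr walk0 subr0 -[n.+2]addn1 natrD addrC addrK walk_peak. Qed.

End walk.

(** * The mixture measure and its normalization *)

Section mixture.
Variables (R : realType) (cost : nat -> nat -> R).
Hypothesis cost_ge0 : forall N m, 0 <= cost N m.

(* Layer [n] has [n.+2 * n.*2.+2] atoms, and the first factors sum to 1. *)
Definition share n : R := (n.+1%:R * n.+2%:R)^-1 / (n.+2%:R * n.*2.+2%:R).

Lemma share_gt0 n : 0 < share n.
Proof. by rewrite /share divr_gt0 ?invr_gt0// mulr_gt0. Qed.

Definition weight n m : R := share n * expR (- cost n.+1 m).

Lemma weight_gt0 n m : 0 < weight n m.
Proof. by rewrite /weight mulr_gt0 ?share_gt0 ?expR_gt0. Qed.

(** Assembled from combinators on measures, so that its measure structure is inferred. *)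
Definition mixture : set nat -> \bar R :=
  mseries (fun n => msum (fun m => msum (fun j =>
    mscale (NngNum (ltW (weight_gt0 n m))) (\d_(code n m j)))
    n.*2.+2) n.+2) 0.

HB.instance Definition _ := Measure.on mixture.

Lemma mixtureE A : mixture A =
  (\sum_(n <oo) \sum_(m < n.+2) \sum_(j < n.*2.+2)
     (weight n m)%:E * \d_(code n m j) A)%E.
Proof. by []. Qed.

Local Lemma term_ge0 A n m j : (0 <= (weight n m)%:E * \d_(code n m j) A)%E.
Proof. by apply: mule_ge0 => //; rewrite lee_fin ltW// weight_gt0. Qed.

Local Lemma layer_ge0 A n :
  (0 <= \sum_(m < n.+2) \sum_(j < n.*2.+2)
    (weight n m)%:E * \d_(code n m j) A)%E.
Proof.
by apply: sume_ge0 => m _; apply: sume_ge0 => j _; exact: term_ge0.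
Qed.

(** The weight does not depend on the phase, and a rotation permutes the phases of each layer. *)
Lemma mixture_shift (d : int) (A B : set nat) :
  (forall n m (j : 'I_n.*2.+2),
     A (code n m j) <-> B (code n m (j + d%:~R)%R)) ->
  mixture A = mixture B.
Proof.
move=> AB; rewrite !mixtureE; apply: eq_eseriesr => n _.
apply: eq_bigr => m _.
rewrite [RHS](reindex_inj (addIr (d%:~R : 'I_n.*2.+2))).
apply: eq_bigr => j _; rewrite !diracE; congr (_ * _%:R%:E)%E; congr nat_of_bool.
by apply/idP/idP; rewrite !inE => /AB.
Qed.

Lemma mixture_ge_weight (A : set nat) n (m : 'I_n.+2) (j : 'I_n.*2.+2) :
  A (code n m j) -> ((weight n m)%:E <= mixture A)%E.
Proof.
move=> Aj; rewrite mixtureE.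
rewrite (nneseriesD1 (n := n)) //; last by move=> k _; exact: layer_ge0.
apply: le_trans (leeDl _ _); last first.
  by apply: nneseries_ge0 => k _ _; exact: layer_ge0.
rewrite (bigD1 m) //=; apply: le_trans (leeDl _ _); last first.
  by apply: sume_ge0 => m' _; apply: sume_ge0 => j' _; exact: term_ge0.
rewrite (bigD1 j) //= diracE mem_set // mule1 leeDl //.
by apply: sume_ge0 => j' _; exact: term_ge0.
Qed.

Lemma sum_share_le1 :
  (\sum_(n <oo) ((n.+1%:R * n.+2%:R : R)^-1)%:E <= 1)%E.
Proof.
apply: lime_le.
  by apply: is_cvg_ereal_nneg_natsum => n _; rewrite lee_fin invr_ge0 mulr_ge0.
apply: nearW => k; rewrite sumEFin lee_fin.
have -> : \sum_(0 <= n < k) (n.+1%:R * n.+2%:R : R)^-1 = 1 - k.+1%:R^-1.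
  elim: k => [|k ih]; first by rewrite big_nil invr1 subrr.
  rewrite big_nat_recr //= ih -!(natr1 k.+1).
  have : (k.+1%:R : R) != 0 by rewrite pnatr_eq0.
  have : (k.+1%:R + 1 : R) != 0 by rewrite natr1 pnatr_eq0.
  by move: (k.+1%:R : R) => x x1 x0; field; rewrite x0 x1.
by rewrite lerBlDr lerDl invr_ge0.
Qed.

(** Each atom in [A] weighs at most its share times exp(-E), and all shares together sum to at most
    1, so the union over signals costs no extra factor. *)
Lemma mixture_le_exp (A : set nat) (E : R) :
  (forall n (m : 'I_n.+2) (j : 'I_n.*2.+2), A (code n m j) ->
     E <= cost n.+1 m) ->
  (mixture A <= (expR (- E))%:E)%E.
Proof.
move=> EA; rewrite mixtureE.
apply: (@le_trans _ _
    (\sum_(n <oo) (expR (- E))%:E * ((n.+1%:R * n.+2%:R : R)^-1)%:E)%E).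
  apply: lee_nneseries => [n _ _|n _]; first exact: layer_ge0.
  apply: (@le_trans _ _
    (\sum_(m < n.+2) \sum_(j < n.*2.+2) (share n * expR (- E))%:E)%E).
    apply: lee_sum => m _; apply: lee_sum => j _.
    rewrite diracE; case: (boolP (_ \in A)) => [|_].
      rewrite inE => /EA Em.
      by rewrite mule1 lee_fin ler_pM2l ?share_gt0// ler_expR lerN2.
    by rewrite mule0 lee_fin mulr_ge0 ?expR_ge0 ?ltW ?share_gt0.
  under eq_bigr do rewrite sumEFin sumr_const card_ord.
  rewrite sumEFin sumr_const card_ord -EFinM lee_fin -mulrnA.
  rewrite -[leLHS]mulr_natr natrM [_.*2.+2%:R * _]mulrC mulrAC /share.
  by rewrite divfK ?mulf_neq0 ?pnatr_eq0// mulrC.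
rewrite nneseriesZl; last by move=> n _; rewrite lee_fin invr_ge0 mulr_ge0.
by rewrite -[leRHS]mule1 lee_wpmul2l ?sum_share_le1// lee_fin expR_ge0.
Qed.

Lemma mixtureT_le1 : (mixture setT <= 1)%E.
Proof.
by rewrite (le_trans (@mixture_le_exp setT 0 _)) ?oppr0 ?expR0.
Qed.

Lemma mixtureT_gt0 : (0 < mixture setT)%E.
Proof.
apply: lt_le_trans (@mixture_ge_weight setT 0 ord0 ord0 I).
by rewrite lte_fin weight_gt0.
Qed.

Definition mass : R := fine (mixture setT).

Lemma mass_gt0 : 0 < mass.
Proof.
by rewrite fine_gt0 // mixtureT_gt0 (le_lt_trans mixtureT_le1)// ltry.
Qed.

(** The Dirac mass is the fallback of [mnormalize] for total mass 0 or infinity; here the total mass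
    lies in (0, 1]. *)
Definition law : set nat -> \bar R := mnormalize mixture \d_0%N.

HB.instance Definition _ := Probability.on law.

Lemma lawE A : law A = (mixture A * mass^-1%:E)%E.
Proof.
rewrite /law /mnormalize gt_eqF ?mixtureT_gt0 //= lt_eqF //.
by rewrite (le_lt_trans mixtureT_le1)// ltry.
Qed.

Lemma law_ge_weight (A : set nat) n (m : 'I_n.+2) (j : 'I_n.*2.+2) :
  A (code n m j) -> ((weight n m / mass)%:E <= law A)%E.
Proof.
move=> Aj; rewrite lawE EFinM lee_wpmul2r//.
  by rewrite lee_fin invr_ge0 ltW// mass_gt0.
exact: mixture_ge_weight Aj.
Qed.

Lemma law_le_exp (A : set nat) (E : R) :
  (forall n (m : 'I_n.+2) (j : 'I_n.*2.+2), A (code n m j) ->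
     E <= cost n.+1 m) ->
  (law A <= (expR (- E) / mass)%:E)%E.
Proof.
move=> EA; rewrite lawE EFinM lee_wpmul2r//.
  by rewrite lee_fin invr_ge0 ltW// mass_gt0.
exact: mixture_le_exp.
Qed.

End mixture.

(** * The process and its stationarity *)

Section process.
Variables (R : realType) (cost : nat -> nat -> R).
Hypothesis cost_ge0 : forall N m, 0 <= cost N m.

Lemma measurable_wave k : measurable_fun setT (@wave R k).
Proof. by []. Qed.

HB.instance Definition _ k :=
  isMeasurableFun.Build _ _ _ _ (@wave R k) (measurable_wave k).

Definition process (k : int) : {RV @law R cost >-> R} := @wave R k.

Lemma stationary_process : stationary process.
Proof.
move=> n m m' A _; rewrite /pushforward /= !lawE //. congr (_ * _)%E.
(* The window from [m] at phase j is the window from [m'] at phase j + (m - m'). *)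
apply: (@mixture_shift _ _ (m - m')) => p q j.
rewrite /preimage /mkset; suff -> : window process m n (code p q j) =
          window process m' n (code p q (j + (m - m')%:~R)%R) by [].
apply: eq_from_tnth => i; rewrite !tnth_mktuple /process /=.
by rewrite -wave_shift; congr wave; rewrite addrAC addrCA subrr addr0.
Qed.

End process.

(** * Growth of powers and of the logarithm *)

Section growth.
Variable R : realType.
Implicit Types a e K : R.

Lemma cvg_natpowR_pinfty a : 0 < a -> n%:R `^ a @[n --> \oo] --> +oo.
Proof.
move=> a_gt0; apply/cvgryPge => K.
have K1 : 0 <= Num.max K 1 by rewrite le_max ler01 orbT.
near=> n.
have n_ge : (Num.max K 1) `^ a^-1 <= n%:R.
  by near: n; exact: nbhs_infty_ger.
apply: (@le_trans _ _ (Num.max K 1)); first by rewrite le_max lexx.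
move: (Num.max K 1) K1 n_ge => M M_ge0 n_ge.
rewrite -[leLHS]powRr1 // -[in leLHS](mulVf (lt0r_neq0 a_gt0)) powRrM.
by apply: ge0_ler_powR; rewrite ?nnegrE ?powR_ge0 // ltW.
Unshelve. all: by end_near. Qed.

Lemma cvg_natpowRN a : 0 < a -> n%:R `^ (- a) @[n --> \oo] --> (0 : R).
Proof.
move=> a_gt0.
under eq_fun do rewrite powRN.
apply/(@gtr0_cvgV0 _ _ _ _ (fun n : nat => n%:R `^ a)).
  near=> n; rewrite powR_gt0 // ltr0n.
  by near: n; exact: nbhs_infty_gt.
exact: cvg_natpowR_pinfty.
Unshelve. all: by end_near. Qed.

(** The discount on costs: unbounded, yet below every power. The summand 1 keeps it at least 1
    everywhere, also at 0 where [ln] is 0. *)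
Definition slow (N : nat) : R := 1 + ln N%:R.

Lemma slow_ge1 N : 1 <= slow N.
Proof.
rewrite /slow lerDl; case: N => [|N]; first by rewrite ln0.
by rewrite ln_ge0 // ler1n.
Qed.

Lemma slow_gt0 N : 0 < slow N.
Proof. exact: lt_le_trans ltr01 (slow_ge1 N). Qed.

Lemma slow_le N : (0 < N)%N -> slow N <= N%:R.
Proof.
move=> N_gt0; rewrite /slow -lerBrDl.
have := @le_ln1Dx R (N%:R - 1); rewrite (_ : 1 + _ = N%:R); last by ring.
apply.
by rewrite ltrBrDl subrr ltr0n.
Qed.

Lemma cvg_slow_pinfty : slow n @[n --> \oo] --> +oo.
Proof.
apply/cvgryPge => K; near=> n.
have n_ge : expR K <= n%:R by near: n; exact: nbhs_infty_ger.
have n_gt0 : 0 < n%:R :> R := lt_le_trans (expR_gt0 K) n_ge.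
apply: (@le_trans _ _ (ln n%:R)); last by rewrite /slow lerDr.
by rewrite -ler_expR lnK // posrE.
Unshelve. all: by end_near. Qed.

Lemma cvg_slowV : (slow n)^-1 @[n --> \oo] --> (0 : R).
Proof.
apply/(@gtr0_cvgV0 _ _ _ _ slow); last exact: cvg_slow_pinfty.
by apply: nearW => n; exact: slow_gt0.
Qed.

(** Half of the exponent absorbs the logarithm: ln n = (2/a) ln n^(a/2) <= (2/a) n^(a/2). *)
Lemma cvg_slowM a : 0 < a -> slow n * n%:R `^ (- a) @[n --> \oo] --> (0 : R).
Proof.
move=> a_gt0; have a2 : 0 < a / 2 by rewrite divr_gt0.
apply: (@squeeze_cvgr _ _ _ _ (fun=> 0)
   (fun n : nat => n%:R `^ (- a) + (a / 2)^-1 * n%:R `^ (- (a / 2)))).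
- near=> n.
  have n_gt0 : 0 < n%:R :> R by rewrite ltr0n; near: n; exact: nbhs_infty_gt.
  rewrite mulr_ge0 ?powR_ge0 ?(ltW (slow_gt0 _)) //=.
  rewrite /slow mulrDl mul1r lerD2l.
  have -> : - (a / 2) = a / 2 + - a by field.
  rewrite powRD; last by rewrite (gt_eqF n_gt0) implybT.
  rewrite mulrA ler_wpM2r ?powR_ge0 // ler_pdivlMl // -ln_powR.
  by rewrite ltW // ln_sublinear // powR_gt0.
- exact: cvg_cst.
- rewrite -[X in _ --> X](addr0 0) -[X in _ --> _ + X](mulr0 (a / 2)^-1).
  apply: cvgD; first exact: cvg_natpowRN.
  by apply: cvgMr; exact: cvg_natpowRN.
Unshelve. all: by end_near. Qed.

Lemma near_slow_le K a : 0 < K -> 0 < a ->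
  \forall n \near \oo, slow n <= K * n%:R `^ a.
Proof.
move=> K_gt0 a_gt0; near=> n.
have n_gt0 : 0 < n%:R :> R by rewrite ltr0n; near: n; exact: nbhs_infty_gt.
rewrite -ler_pdivrMr ?powR_gt0 // -powRN.
near: n; apply: (cvgr_le 0); first exact: cvg_slowM.
exact: K_gt0.
Unshelve. all: by end_near. Qed.

End growth.

(** * The cost of a signal and its lower bound near G1 exponents *)

Section cost.
Variables (R : realType) (G0 : set R).
Implicit Types c t gamma delta : R.

Definition in_G0 (N m : nat) : Prop :=
  exists2 g, G0 g & m%:R = N%:R `^ (2^-1 + g).

Definition cost (N m : nat) : R :=
  m%:R ^+ 2 / (2 * N%:R) / (if `[< in_G0 N m >] then slow R N else 1).

Lemma cost_ge0 N m : 0 <= cost N m.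
Proof.
rewrite /cost !divr_ge0 ?sqr_ge0 ?mulr_ge0 //.
by case: ifP => // _; rewrite ltW // slow_gt0.
Qed.

Lemma cost_le N m : cost N m <= m%:R ^+ 2 / (2 * N%:R).
Proof.
have x_ge0 : 0 <= m%:R ^+ 2 / (2 * N%:R) :> R.
  by rewrite divr_ge0 ?sqr_ge0 ?mulr_ge0.
rewrite /cost; case: ifP => _; last by rewrite divr1.
rewrite ler_pdivrMr ?slow_gt0 // -[leLHS]mulr1 ler_wpM2l //.
exact: slow_ge1.
Qed.

Lemma powR_half_sqr (x a : R) : 0 < x ->
  (x `^ (2^-1 + a)) ^+ 2 = x * x `^ (2 * a).
Proof.
move=> x0; rewrite -powR_mulrn ?powR_ge0 // -powRrM.
have -> : (2^-1 + a) * 2 = 1 + 2 * a by field.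
by rewrite powRD ?(gt_eqF x0) ?implybT // powRr1 // ltW.
Qed.

(** A signal whose n-sums reach t satisfies m >= t and n m / N >= t. The first bound serves when n
    >= N L, the second when N >= n L; either way m^2 / N is at least L times t^2 / n. *)
Lemma sqr_peak_ge (n N m : nat) (t L : R) : (0 < n)%N -> (0 < N)%N -> 0 <= t ->
  t <= m%:R -> t * N%:R <= n%:R * m%:R ->
  N%:R * L <= n%:R \/ n%:R * L <= N%:R ->
  t ^+ 2 * (N%:R * L) <= m%:R ^+ 2 * n%:R.
Proof.
rewrite -(ltr0n R) => n_gt0; rewrite -(ltr0n R) => N_gt0 t_ge0.
move: (n%:R : R) (N%:R : R) (m%:R : R) n_gt0 N_gt0 => x y z x0 y0 tz tyxz.
have z_ge0 : 0 <= z := le_trans t_ge0 tz.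
case=> h.
  apply: (@le_trans _ _ (t ^+ 2 * x)); first by rewrite ler_wpM2l ?sqr_ge0.
  by rewrite ler_wpM2r ?(ltW x0) // ler_sqr ?nnegrE.
rewrite -(ler_pM2r x0).
apply: (@le_trans _ _ ((t * y) ^+ 2)).
  have -> : t ^+ 2 * (y * L) * x = (t ^+ 2 * y) * (x * L) by ring.
  have -> : (t * y) ^+ 2 = (t ^+ 2 * y) * y by ring.
  by rewrite ler_wpM2l // mulr_ge0 ?sqr_ge0 // ltW.
have -> : z ^+ 2 * x * x = (x * z) ^+ 2 by ring.
by rewrite ler_sqr ?nnegrE // mulr_ge0 // ltW.
Qed.

(** As 1/2 + gamma < 1, N^(1/2 + gamma) <= n^(1/2 + gamma) L. Hence m > c N^(1/2 + gamma) / L >=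
    N^(1/2 + gamma - delta) >= N^(1/2 + g) = m. *)
Lemma peak_contradiction c gamma delta g (n N m : nat) (L : R) :
  0 < c -> 0 < gamma < 2^-1 -> (0 < N)%N -> 1 <= L ->
  N%:R <= n%:R * L -> L <= c * N%:R `^ delta -> g <= gamma - delta ->
  c * n%:R `^ (2^-1 + gamma) < m%:R -> m%:R = N%:R `^ (2^-1 + g) -> False.
Proof.
move=> c0 /andP[g0 g2] N0 L1 NnL Lc gle tm mE.
have L0 : 0 < L := lt_le_trans ltr01 L1.
have NR0 : 0 < N%:R :> R by rewrite ltr0n.
have h : c * N%:R `^ (2^-1 + gamma) < L * N%:R `^ (2^-1 + gamma - delta).
  apply: (@le_lt_trans _ _ (L * (c * n%:R `^ (2^-1 + gamma)))).
    rewrite mulrCA ler_wpM2l ?(ltW c0) //.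
    apply: (@le_trans _ _ ((n%:R * L) `^ (2^-1 + gamma))).
      by apply: ge0_ler_powR => //; rewrite ?nnegrE ?mulr_ge0 //; lra.
    rewrite powRM ?(ltW L0) // mulrC ler_wpM2r ?powR_ge0 //.
    by apply: ler1_powR => //; lra.
  rewrite ltr_pM2l //; apply: (lt_le_trans tm); rewrite mE.
  by apply: ler_powR; [rewrite ler1n | lra].
move: h; apply/negP; rewrite -leNgt.
have -> : N%:R `^ (2^-1 + gamma) =
    N%:R `^ delta * N%:R `^ (2^-1 + gamma - delta) :> R.
  by rewrite -powRD ?(gt_eqF NR0) ?implybT //; congr (_ `^ _); ring.
by rewrite mulrA ler_wpM2r ?powR_ge0.
Qed.

(** N^(2g) >= N^(2 gamma) (c L)^2. One factor L turns N^(2 gamma) into n^(2 gamma), as 2 gamma < 1;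
    the other is left to pay for the discount. *)
Lemma peak_costly c gamma delta g (n N : nat) (L : R) :
  0 < c -> 0 < gamma < 2^-1 -> (0 < N)%N -> 1 <= L ->
  n%:R <= N%:R * L -> c * L <= N%:R `^ delta -> gamma + delta <= g ->
  c ^+ 2 * n%:R `^ (2 * gamma) * L <= N%:R `^ (2 * g).
Proof.
move=> c0 /andP[g0 g2] N0 L1 nNL cL gge.
have L0 : 0 < L := lt_le_trans ltr01 L1.
have NR0 : 0 < N%:R :> R by rewrite ltr0n.
apply: (@le_trans _ _ (N%:R `^ (2 * gamma) * (N%:R `^ delta) ^+ 2)); last first.
  rewrite -powR_mulrn ?powR_ge0 // -powRrM -powRD ?(gt_eqF NR0) ?implybT //.
  by apply: ler_powR; [rewrite ler1n | lra].
apply: (@le_trans _ _ (N%:R `^ (2 * gamma) * (c * L) ^+ 2)); last first.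
  rewrite ler_wpM2l ?powR_ge0 // ler_sqr ?nnegrE ?powR_ge0 //.
  by rewrite mulr_ge0 ?(ltW c0) ?(ltW L0).
have -> : N%:R `^ (2 * gamma) * (c * L) ^+ 2 =
  c ^+ 2 * (N%:R `^ (2 * gamma) * L) * L by ring.
rewrite ler_wpM2r ?(ltW L0) // ler_wpM2l ?sqr_ge0 //.
apply: (@le_trans _ _ ((N%:R * L) `^ (2 * gamma))).
  by apply: ge0_ler_powR => //; rewrite ?nnegrE ?mulr_ge0 ?(ltW L0) //; lra.
rewrite powRM ?(ltW L0) // ler_wpM2l ?powR_ge0 //.
by apply: ler1_powR => //; lra.
Qed.

Lemma near_cost_ge c gamma delta : 0 < c -> 0 < gamma < 2^-1 -> 0 < delta ->
  (forall g, G0 g -> g <= gamma - delta \/ gamma + delta <= g) ->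
  \forall n \near \oo, forall N m : nat, (0 < N)%N ->
    c * n%:R `^ (2^-1 + gamma) < m%:R ->
    c * n%:R `^ (2^-1 + gamma) * N%:R < n%:R * m%:R ->
    2^-1 * c ^+ 2 * n%:R `^ (2 * gamma) <= cost N m.
Proof.
move=> c0 gamma12 d0 G0far.
(* The two inequalities are what [peak_contradiction] and [peak_costly] ask of L. *)
have [N0 _ N0P] : \forall N \near \oo,
    slow R N <= c * N%:R `^ delta /\ c * slow R N <= N%:R `^ delta.
  near=> N; split; first by near: N; exact: near_slow_le.
  rewrite -ler_pdivlMl //; near: N; apply: near_slow_le => //.
  by rewrite invr_gt0.
near=> n => N m N_gt0 tm tNnm.
have n_gt0 : (0 < n)%N by near: n; exact: nbhs_infty_gt.
(* Squared because the last case has n < N L <= N^2, which then yields N0 <= N. *)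
have nN0 : (N0 ^ 2 <= n)%N by near: n; exact: nbhs_infty_ge.
have nR0 : 0 < n%:R :> R by rewrite ltr0n.
have NR0 : 0 < N%:R :> R by rewrite ltr0n.
have t_ge0 : 0 <= c * n%:R `^ (2^-1 + gamma) by rewrite mulr_ge0 ?powR_ge0 ?ltW.
have reduce L : 0 < L ->
    (c * n%:R `^ (2^-1 + gamma)) ^+ 2 * (N%:R * L) <= m%:R ^+ 2 * n%:R ->
    2^-1 * c ^+ 2 * n%:R `^ (2 * gamma) <= m%:R ^+ 2 / (2 * N%:R) / L.
  move=> L0; rewrite exprMn powR_half_sqr //.
  rewrite ler_pdivlMr // ler_pdivlMr ?mulr_gt0 // => h.
  rewrite -(ler_pM2r nR0); apply: le_trans h.
  by rewrite le_eqVlt; apply/orP; left; apply/eqP; field.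
(* Without discount L = 1 suffices, and then one alternative of [sqr_peak_ge] always holds. *)
rewrite /cost; have [[g G0g mE]|_] := asboolP (in_G0 N m); last first.
  apply: reduce => //; apply: sqr_peak_ge => //; try exact: ltW.
  by rewrite !mulr1; apply/orP; exact: le_total.
set L := slow R N.
have L1 : 1 <= L by exact: slow_ge1.
have L0 : 0 < L by exact: slow_gt0.
(* If n and N differ by a factor L or more, the gain in [sqr_peak_ge] pays for the discount. *)
have [NLn|nNL] := leP (N%:R * L) n%:R.
  apply: reduce => //; apply: sqr_peak_ge => //; try exact: ltW.
  by left.
have [nLN|NnL] := leP (n%:R * L) N%:R.
  apply: reduce => //; apply: sqr_peak_ge => //; try exact: ltW.
  by right.
have NN0 : (N0 <= N)%N.
  rewrite -leq_sqr -(ler_nat R); apply: (@le_trans _ _ n%:R).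
    by rewrite ler_nat.
  rewrite (le_trans (ltW nNL)) // natrX expr2 ler_wpM2l //.
  exact: slow_le.
have [Lc cL] := N0P N NN0.
(* With n and N comparable, exponents below gamma cannot reach the level, and those above it cost
   enough even when discounted. *)
case: (G0far g G0g) => [gle|gge].
  exfalso; apply: (@peak_contradiction c gamma delta g n N m L) => //.
  exact: ltW.
rewrite ler_pdivlMr // ler_pdivlMr ?mulr_gt0 //.
rewrite mE powR_half_sqr //.
have := @peak_costly c gamma delta g n N L c0 gamma12 N_gt0 L1 (ltW nNL) cL gge.
move=> /(ler_wpM2l (ltW NR0)); apply: le_trans.
by rewrite le_eqVlt; apply/orP; left; apply/eqP; field.
Unshelve. all: by end_near. Qed.

End cost.

(** * Asymptotics of integer peaks and of the shares *)

(** The exponent ln m / ln n - 1/2 tends to gamma, since n^(-e) < c and c + 1 < n^e eventually;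
    openness of [G0] then captures it. *)
Lemma near_in_G0 (R : realType) (G0 : set R) (c gamma : R) :
  open G0 -> G0 gamma -> 0 < c -> 0 < gamma ->
  \forall n \near \oo, forall m : nat,
    c * n%:R `^ (2^-1 + gamma) < m%:R <= c * n%:R `^ (2^-1 + gamma) + 1 ->
    in_G0 R G0 n m.
Proof.
move=> G0_open G0g c0 g0.
have [e /= e0 eG0] : nbhs_ball gamma G0.
  by apply/nbhs_ballP; exact: open_nbhs_nbhs.
near=> n => m /andP[tm mt].
have n1 : 1 < n%:R :> R by rewrite ltr1n; near: n; exact: nbhs_infty_gt.
have n0 : 0 < n%:R :> R := lt_trans ltr01 n1.
have lnn0 : 0 < ln n%:R :> R by exact: ln_gt0.
have m0 : 0 < m%:R :> R by apply: le_lt_trans tm; rewrite mulr_ge0 ?powR_ge0 ?ltW.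
have powD a b : n%:R `^ (a + b) = n%:R `^ a * n%:R `^ b :> R.
  by rewrite powRD // (gt_eqF n0) implybT.
exists (ln m%:R / ln n%:R - 2^-1); last first.
  by rewrite addrC subrK /powR (gt_eqF n0) divfK ?gt_eqF // lnK.
apply: eG0; rewrite /ball /= ltr_distlC; apply/andP; split.
  rewrite ltrBrDl addrA ltr_pdivlMr // -ln_powR ltr_ln ?posrE ?powR_gt0 //.
  apply: lt_trans tm; rewrite powD mulrC ltr_pM2r ?powR_gt0 //.
  near: n; apply: (cvgr_lt 0) => //; exact: cvg_natpowRN.
rewrite ltrBlDl addrA ltr_pdivrMr // -ln_powR ltr_ln ?posrE ?powR_gt0 //.
apply: (le_lt_trans mt).
apply: (@le_lt_trans _ _ ((c + 1) * n%:R `^ (2^-1 + gamma))).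
  by rewrite mulrDl mul1r lerD2l -[leLHS](powRr0 n%:R) ler_powR ?(ltW n1) //; lra.
rewrite [ltRHS]powD mulrC ltr_pM2l ?powR_gt0 //.
near: n.
have /cvgryPgt := cvg_natpowR_pinfty R e e0.
exact.
Unshelve. all: by end_near. Qed.

(** The inverse of [share] is a quartic in N = [n.+1], at most (2N)^4, and ln 2 <= 1. Singling out
    one signal thus costs only a logarithm in the exponent. *)
Lemma ln_share_ge (R : realType) n : - (4 * slow R n.+1) <= ln (share R n).
Proof.
have n0 : 0 < n.+1%:R :> R by rewrite ltr0n.
have -> : 4 * slow R n.+1 = 4 + 4 * ln n.+1%:R by rewrite /slow; ring.
have ln2 : ln 2 <= 1 :> R by apply: (@le_ln1Dx R 1); lra.
apply: (@le_trans _ _ (ln ((2 * n.+1%:R) ^+ 4)^-1)); last first.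
  rewrite ler_ln ?posrE ?share_gt0 ?invr_gt0 ?exprn_gt0 ?mulr_gt0 //.
  rewrite /share -invfM lef_pV2 ?posrE ?exprn_gt0 ?mulr_gt0 //.
  have -> : n.+2%:R = n.+1%:R + 1 :> R by rewrite natr1.
  have -> : n.*2.+2%:R = 2 * n.+1%:R :> R by rewrite -doubleS -mul2n natrM.
  have : 1 <= n.+1%:R :> R by rewrite ler1n.
  move: (n.+1%:R : R) => x x1.
  have -> : (2 * x) ^+ 4 = (x * (2 * x)) * ((2 * x) * (2 * x) * 2) by ring.
  have -> : x * (x + 1) * ((x + 1) * (2 * x)) =
    (x * (2 * x)) * ((x + 1) * (x + 1)) by ring.
  rewrite ler_pM2l; last by rewrite !mulr_gt0 //; lra.
  have : (x + 1) * (x + 1) <= (2 * x) * (2 * x) by apply: ler_pM; lra.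
  have : 0 <= (2 * x) * (2 * x) by apply: mulr_ge0; lra.
  by move: ((x + 1) * _) (2 * x * _) => u v; lra.
rewrite lnV ?posrE ?exprn_gt0 ?mulr_gt0 // lerN2.
rewrite lnXn ?mulr_gt0 // lnM ?posrE // -[leLHS]mulr_natl; lra.
Qed.

(** * Bounds and limits for deviation probabilities *)

Section deviation.
Variables (R : realType) (cost : nat -> nat -> R).
Hypothesis cost_ge0 : forall N m, 0 <= cost N m.
Implicit Types c gamma k : R.

Definition deviation c gamma (n : nat) : set nat :=
  [set w | c * n%:R `^ gamma <
    (\sum_(1 <= k < n.+1) process R cost k%:Z w) / Num.sqrt n%:R].

Lemma deviationE c gamma n w : (0 < n)%N -> deviation c gamma n w =
  (c * n%:R `^ (2^-1 + gamma) < \sum_(1 <= k < n.+1) wave R k%:Z w) :> Prop.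
Proof.
move=> n0; have nR0 : 0 < n%:R :> R by rewrite ltr0n.
rewrite /deviation /= ltr_pdivlMr ?sqrtr_gt0 // -powR12_sqrt ?ltW // -mulrA.
by rewrite -powRD ?(gt_eqF nR0) ?implybT // addrC.
Qed.

Definition deviation_prob c gamma n : R := fine (law R cost (deviation c gamma n)).

Lemma deviation_probE c gamma n :
  law R cost (deviation c gamma n) = (deviation_prob c gamma n)%:E.
Proof. by rewrite fineK // fin_num_measure. Qed.

Lemma deviation_prob_ge c gamma n (m : nat) : (0 < n)%N ->
  c * n%:R `^ (2^-1 + gamma) < m%:R -> (m <= n)%N ->
  share R n.-1 * expR (- cost n m) <= deviation_prob c gamma n.
Proof.
case: n => // n _ tm mn.
(* The total mass is at most 1, so normalizing only increases weights. *)
apply: (@le_trans _ _ (weight R cost n m / mass R cost)).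
  have w0 := weight_gt0 R cost n m.
  rewrite -[leLHS]mulr1 /weight ler_pM2l //.
  rewrite -[leLHS]invr1 lef_pV2 ?posrE ?ltr01 ?mass_gt0 //.
  rewrite -lee_fin fineK ?mixtureT_le1 //.
  rewrite ge0_fin_numE //; apply: le_lt_trans (mixtureT_le1 R cost cost_ge0) _.
  exact: ltry.
rewrite -lee_fin -deviation_probE.
have mlt : (m < n.+2)%N by rewrite ltnS.
apply: (law_ge_weight R cost cost_ge0 _ n (Ordinal mlt) (- 1)%R).
by rewrite deviationE // sum_wave_peak.
Qed.

Lemma deviation_prob_le c gamma n (E : R) : (0 < n)%N ->
  (forall N m : nat, (0 < N)%N ->
    c * n%:R `^ (2^-1 + gamma) < m%:R ->
    c * n%:R `^ (2^-1 + gamma) * N%:R < n%:R * m%:R -> E <= cost N m) ->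
  deviation_prob c gamma n <= expR (- E) / mass R cost.
Proof.
move=> n0 EP; rewrite -lee_fin -deviation_probE.
apply: law_le_exp => // N m j; rewrite deviationE // => tS.
apply: EP => //; first exact: lt_le_trans tS (sum_wave_le_peak _ _ _ _ _).
rewrite -ltr_pdivlMr // -mulrA.
exact: lt_le_trans tS (sum_wave_le_slope _ _ _ _ _).
Qed.

(** The squeeze shared by both regions. [kappa] bounds the cost relative to m^2 / 2n at the first
    integer above the level; the lower bound is derived here from one signal, the upper bound [up]
    is supplied by each region. *)
Lemma cvg_ln_deviation c gamma k (kappa up : nat -> R) :
  0 < c -> 0 < gamma < 2^-1 ->
  (\forall n \near \oo, forall m : nat,
    c * n%:R `^ (2^-1 + gamma) < m%:R <= c * n%:R `^ (2^-1 + gamma) + 1 ->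
    cost n m <= m%:R ^+ 2 / (2 * n%:R) * kappa n) ->
  (forall n, 0 <= kappa n) ->
  kappa n @[n --> \oo] --> k ->
  (\forall n \near \oo, 0 < deviation_prob c gamma n ->
     (n%:R `^ (2 * gamma))^-1 * ln (deviation_prob c gamma n) <= up n) ->
  up n @[n --> \oo] --> - (2^-1 * c ^+ 2 * k) ->
  ((n%:R `^ (2 * gamma))^-1%:E * lne (law R cost (deviation c gamma n)))%E
    @[n --> \oo] --> (- (2^-1 * c ^+ 2 * k))%:E.
Proof.
move=> c0 /andP[g0 g2] cost_kappa kappa_ge0 kappa_cvg ln_up up_cvg.
(* The first term comes from [share], the second from the cost at m <= c n^(1/2 + gamma) + 1, both
   divided by n^(2 gamma). *)
pose low n : R := - (4 * (slow R n * n%:R `^ (- (2 * gamma))) +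
  2^-1 * (c + n%:R `^ (- (2^-1 + gamma))) ^+ 2 * kappa n).
have low_cvg : low n @[n --> \oo] --> - (2^-1 * c ^+ 2 * k).
  rewrite -[X in _ --> - X]add0r -[X in _ --> - (X + _)](mulr0 4).
  apply: cvgN; apply: cvgD; first by apply: cvgMr; apply: cvg_slowM; lra.
  apply: cvgM => //; apply: cvgMr.
  have h : c + n%:R `^ (- (2^-1 + gamma)) @[n --> \oo] --> c.
    rewrite -[X in _ --> X]addr0; apply: cvgD; first exact: cvg_cst.
    by apply: cvg_natpowRN; lra.
  by rewrite expr2; under eq_fun do rewrite expr2; exact: cvgM.
suff : \forall n \near \oo, 0 < deviation_prob c gamma n /\
    low n <= (n%:R `^ (2 * gamma))^-1 * ln (deviation_prob c gamma n).
  move=> lowP.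
  apply: (@cvg_trans _
    (((n%:R `^ (2 * gamma))^-1 * ln (deviation_prob c gamma n))%:E
       @[n --> \oo])).
    apply: near_eq_cvg; near=> n.
    have [p0 _] : 0 < deviation_prob c gamma n /\
      low n <= (n%:R `^ (2 * gamma))^-1 * ln (deviation_prob c gamma n).
      by near: n.
    by rewrite deviation_probE lne_EFin // EFinM.
  apply: cvg_EFin; first by apply: nearW.
  apply: (@squeeze_cvgr _ _ _ _ low up) => //.
  near=> n.
  have [p0 lown] : 0 < deviation_prob c gamma n /\
    low n <= (n%:R `^ (2 * gamma))^-1 * ln (deviation_prob c gamma n).
    by near: n.
  by rewrite lown /=; move: p0; near: n.
near=> n.
have n0 : (0 < n)%N by near: n; exact: nbhs_infty_gt.
have nR0 : 0 < n%:R :> R by rewrite ltr0n.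
have cost_n : forall m : nat,
    c * n%:R `^ (2^-1 + gamma) < m%:R <= c * n%:R `^ (2^-1 + gamma) + 1 ->
    cost n m <= m%:R ^+ 2 / (2 * n%:R) * kappa n.
  by near: n; exact: cost_kappa.
have nD a b : n%:R `^ (a + b) = n%:R `^ a * n%:R `^ b :> R.
  by rewrite powRD // (gt_eqF nR0) implybT.
pose t := c * n%:R `^ (2^-1 + gamma).
have t0 : 0 <= t by rewrite mulr_ge0 ?powR_ge0 ?ltW.
pose m := (Num.truncn t).+1.
have tm : t < m%:R by case/andP: (truncn_itv t0).
have mt : m%:R <= t + 1.
  by rewrite /m -natr1 lerD2r; case/andP: (truncn_itv t0).
(* Layer n only has peaks up to n; as gamma < 1/2, the level is o(n). *)
have mn : (m <= n)%N.
  rewrite -(ler_nat R); apply: (le_trans mt).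
  have h1 : c * n%:R `^ (- (2^-1 - gamma)) + n%:R `^ (- 1) <= 1.
    near: n; apply: (cvgr_le (c * 0 + 0 : R)); last by rewrite mulr0 addr0.
    apply: cvgD; last by apply: cvg_natpowRN.
    by apply: cvgMr; apply: cvg_natpowRN; lra.
  have -> : t + 1 =
      n%:R * (c * n%:R `^ (- (2^-1 - gamma)) + n%:R `^ (- 1)).
    rewrite /t powR_inv1 ?ltW // mulrDr mulfV ?gt_eqF //; congr (_ + _).
    rewrite mulrCA; congr (_ * _); rewrite -{2}[n%:R : R]powRr1 ?ltW // -nD.
    by congr (_ `^ _); lra.
  by rewrite -[leRHS]mulr1 ler_pM2l.
have pge := deviation_prob_ge c gamma n m n0 tm mn.
have sh0 : 0 < share R n.-1 * expR (- cost n m).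
  by rewrite mulr_gt0 ?share_gt0 ?expR_gt0.
have p0 : 0 < deviation_prob c gamma n := lt_le_trans sh0 pge.
split=> //.
rewrite ler_pdivlMl ?powR_gt0 //.
apply: (@le_trans _ _ (ln (share R n.-1 * expR (- cost n m)))); last first.
  by rewrite ler_ln.
rewrite lnM ?posrE ?share_gt0 ?expR_gt0 // expRK.
apply: (@le_trans _ _ (- (4 * slow R n) - m%:R ^+ 2 / (2 * n%:R) * kappa n)).
  rewrite /low mulrN mulrDr opprD; apply: lerB.
    rewrite lerN2 le_eqVlt; apply/orP; left; apply/eqP.
    rewrite powRN; field.
    by rewrite gt_eqF ?powR_gt0.
  rewrite mulrA ler_wpM2r //.
  rewrite ler_pdivrMr ?mulr_gt0 //.
  apply: (@le_trans _ _ ((t + 1) ^+ 2)).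
    by rewrite ler_sqr ?nnegrE ?addr_ge0.
  have -> : t + 1 =
      n%:R `^ (2^-1 + gamma) * (c + n%:R `^ (- (2^-1 + gamma))).
    by rewrite mulrDr -nD subrr powRr0 mulrC.
  rewrite exprMn powR_half_sqr //.
  by rewrite le_eqVlt; apply/orP; left; apply/eqP; field.
apply: lerB; first by have := ln_share_ge R n.-1; rewrite prednK.
by apply: cost_n; rewrite tm mt.
Unshelve. all: by end_near. Qed.

End deviation.

(** * Choice of the process and the two regions of exponents *)

Theorem theorem1 (R : realType) (G0 G1 : set R)
    (G0_sub : G0 `<=` `]0, 2^-1[)
    (G0_open : open G0)
    (G0_away : bounded_away_from0 G0)
    (G0_itvs : finite_union_of_intervals G0)
    (G1_def : G1 = interior (`]0, 2^-1[ `\` G0)) :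
  exists (d : measure_display) (T : measurableType d) (P : probability T R)
         (X : int -> {RV P >-> R}),
    stationary X /\
    forall gamma c : R, (G0 `|` G1) gamma -> 0 < c ->
      ((n%:R `^ (2 * gamma))^-1%:E *
       lne (P [set w | c * n%:R `^ gamma <
                 (\sum_(1 <= k < n.+1) X k%:Z w) / Num.sqrt n%:R]%R))%E
        @[n --> \oo]
      --> (if gamma \in G1 then - (2^-1 * c ^+ 2) else 0)%:E.
Proof.
pose C := cost R G0.
have C0 : forall N m, 0 <= C N m by exact: cost_ge0.
exists _, nat, (law R C), (process R C); split; first exact: stationary_process.
move=> gamma c gammaG c0.
case: ifPn => [|gG1].
  rewrite inE G1_def => gG1.
  have := gG1 => /interior_subset [/= +  _].
  rewrite in_itv /= => gamma12.
  (* An interior point of the complement has a ball free of [G0]; its radius is the separation. *)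
  have [delta d0 deltaP] : exists2 delta, 0 < delta &
      forall g, G0 g -> g <= gamma - delta \/ gamma + delta <= g.
    have /nbhs_ballP[e /= e0 eG1] := gG1.
    exists e => // g G0g; apply/orP; apply: contraT; rewrite negb_or -!ltNge.
    move=> ge; have [//|_ []//] := eG1 g.
    by rewrite /ball /= ltr_distlC.
  rewrite -[X in - X]mulr1.
  (* The second term of [up] is the vanishing contribution of the normalizing constant. *)
  apply: (@cvg_ln_deviation R C C0 c gamma 1 (fun=> 1)
    (fun n => - (2^-1 * c ^+ 2) + (- ln (mass R C)) * n%:R `^ (- (2 * gamma)))) => //.
  - apply: nearW => n m _; rewrite mulr1; exact: cost_le.
  - exact: cvg_cst.
  - near=> n => p0.
    have n0 : (0 < n)%N by near: n; exact: nbhs_infty_gt.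
    have nR0 : 0 < n%:R :> R by rewrite ltr0n.
    rewrite ler_pdivrMl ?powR_gt0 //.
    have pE : deviation_prob R C c gamma n <=
        expR (- (2^-1 * c ^+ 2 * n%:R `^ (2 * gamma))) / mass R C.
      apply: deviation_prob_le => //.
      near: n; exact: near_cost_ge deltaP.
    have M0 := mass_gt0 R C C0.
    apply: (@le_trans _ _
      (ln (expR (- (2^-1 * c ^+ 2 * n%:R `^ (2 * gamma))) / mass R C))).
      by rewrite ler_ln ?posrE ?divr_gt0 ?expR_gt0.
    rewrite ln_div ?posrE ?expR_gt0 // expRK powRN.
    rewrite le_eqVlt; apply/orP; left; apply/eqP; field.
    by rewrite gt_eqF ?powR_gt0.
  - rewrite mulr1 -[X in _ --> X]addr0 -[X in _ --> _ + X](mulr0 (- ln (mass R C))).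
    apply: cvgD; first exact: cvg_cst.
    apply: cvgMr; apply: cvg_natpowRN; case/andP: gamma12 => ? _; lra.
have G0g : G0 gamma.
  by case: gammaG => // /mem_set; rewrite (negbTE gG1).
have gamma12 : 0 < gamma < 2^-1 by have := G0_sub _ G0g; rewrite /= in_itv.
rewrite [X in _ --> X%:E](_ : _ = - (2^-1 * c ^+ 2 * 0)); last first.
  by rewrite mulr0 oppr0.
(* The discount sends the relative cost to 0, and the upper bound 0 only says that a probability is
   at most 1. *)
apply: (@cvg_ln_deviation R C C0 c gamma 0 (fun n => (slow R n)^-1) (fun=> 0)) => //.
- have := near_in_G0 R G0 c gamma G0_open G0g c0 _.
  case/andP: gamma12 => g0 _ /(_ g0).
  apply: filterS => n nP m /nP nmG0.
  by rewrite /C /cost; case: asboolP.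
- by move=> n; rewrite invr_ge0 ltW // slow_gt0.
- exact: cvg_slowV.
- near=> n => p0.
  apply: mulr_ge0_le0; first by rewrite invr_ge0 powR_ge0.
  apply: ln_le0; rewrite -lee_fin -deviation_probE.
  exact: probability_le1.
- by rewrite mulr0 oppr0; exact: cvg_cst.
Unshelve. all: by end_near. Qed.
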